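(* Let $(F,+,* )$ be a near-field, $k\ge 1$ a natural number, and $(V,+)=(F^k,+)$ the $k$-fold direct sum of $(F,+)$. For $i\in\{1,\dots,k\}$ let $\alpha_i:F\to F$ be a map with $\alpha_i(0)=0$ whose restriction to $F\setminus\{0\}$ is an automorphism of the multiplicative group $(F\setminus\{0\},* )$, where $\alpha_k$ is the identity map. For $\underline{x}=(x_1,\dots,x_k)$ and $\underline{a}=(a_1,\dots,a_k)$ in $V$ define $$\underline{x}*_1\underline{a}:=(x_1*\alpha_1(a_k),\dots,x_{k-1}*\alpha_{k-1}(a_k),x_k*a_k)\quad\text{if } a_1=a_2=\dots=a_{k-1}=0,$$ $$\underline{x}*_1\underline{a}:=(x_k*a_1,\dots,x_k*a_k)\quad\text{otherwise.}$$ Then $(V,+,*_1)$ is an af-near-ring with group of units $U=\{(0,\dots,0,a)\mid a\in F,\ a\ne0\}$ and identity $(0,\dots,0,1)$, and $(U\cup\{0\},+,*_1)$ is isomorphic to $(F,+,* )$.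
   Context: A near-ring $(N,+,* )$ is a (not necessarily abelian) group $(N,+)$ with identity element $0$ together with a semigroup $(N,* )$ satisfying the right distributive law $(a+b)*c=a*c+b*c$. All near-rings are zero symmetric: $0*n=n*0=0$ for all $n$. For a near-ring with multiplicative identity $1$, $U$ denotes the group of multiplicatively invertible elements (units), and $\psi_u:n\mapsto n*u$. A near-field is a (zero symmetric) near-ring whose non-zero elements form a group under multiplication. An f-near-ring is a zero symmetric near-ring with identity such that for every unit $u$ with $\psi_u\ne\mathrm{id}$, the only $n\in N$ with $n*u=n$ is $n=0$. An a-near-ring is a zero symmetric near-ring with identity such that $U\cup\{0\}$ forms a subnear-field with respect to the near-ring operations (equivalently $1\ne0$ and $U\cup\{0\}$ is a subgroup of $(N,+)$). An af-near-ring is a near-ring that is both an a-near-ring and an f-near-ring. *)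

(* Defs.v *)
From mathcomp Require Import all_boot.
From mathcomp Require Import boolp classical_sets functions.

Set Implicit Arguments.
Unset Strict Implicit.
Unset Printing Implicit Defensive.

Local Open Scope classical_set_scope.

(* MathComp's additive structures are all commutative, whereas the addition of
   a near-ring need not be.  Near-ring data is therefore a bare carrier with
   its operations; the axioms are the predicates below. *)
Record nr_data := NrData {
  nr_sort :> Type;
  nr_zero : nr_sort;
  nr_add : nr_sort -> nr_sort -> nr_sort;
  nr_mul : nr_sort -> nr_sort -> nr_sort }.

Arguments nr_zero {_}.
Arguments nr_add {_} _ _.
Arguments nr_mul {_} _ _.

Declare Scope near_ring_scope.
Delimit Scope near_ring_scope with NR.
Notation "0" := nr_zero : near_ring_scope.
Notation "x + y" := (nr_add x y) : near_ring_scope.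
Notation "x * y" := (nr_mul x y) : near_ring_scope.
Local Open Scope near_ring_scope.

(* The axioms are relative to a subset S, so that the same definitions apply to
   substructures; a structure on the whole type is the case S = setT. *)
Definition closed_on (T : Type) (S : set T) (op : T -> T -> T) : Prop :=
  forall x y, S x -> S y -> S (op x y).

Definition associative_on (T : Type) (S : set T) (op : T -> T -> T) : Prop :=
  forall x y z, S x -> S y -> S z -> op x (op y z) = op (op x y) z.

Definition group_on (T : Type) (S : set T) (op : T -> T -> T) (e : T) : Prop :=
  [/\ closed_on S op, associative_on S op, S e,
      forall x, S x -> op e x = x /\ op x e = x
    & forall x, S x -> exists y, [/\ S y, op x y = e & op y x = e]].

Definition near_ring_on (N : nr_data) (S : set N) : Prop :=
  [/\ group_on S nr_add (0 : N),
      closed_on S nr_mul,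
      associative_on S nr_mul,
      forall a b c : N, S a -> S b -> S c -> (a + b) * c = a * c + b * c
    & forall n : N, S n -> 0 * n = 0 /\ n * 0 = 0].

Definition near_field_on (N : nr_data) (S : set N) : Prop :=
  near_ring_on S /\ exists e : N, group_on (S `\ 0) nr_mul e.

Definition near_ring (N : nr_data) : Prop := near_ring_on [set: N].

Definition near_field (N : nr_data) : Prop := near_field_on [set: N].

Definition is_identity (N : nr_data) (e : N) : Prop :=
  forall n : N, e * n = n /\ n * e = n.

Definition near_ring_with_identity (N : nr_data) : Prop :=
  near_ring N /\ exists e : N, is_identity e.

Definition units (N : nr_data) : set N :=
  [set u | exists e v : N, [/\ is_identity e, u * v = e & v * u = e]].

Arguments units N _ : clear implicits.

Definition psi (N : nr_data) (u : N) : N -> N := fun n => n * u.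

Definition f_near_ring (N : nr_data) : Prop :=
  near_ring_with_identity N /\
  forall u : N, units N u -> psi u <> id -> forall n : N, n * u = n -> n = 0.

Definition a_near_ring (N : nr_data) : Prop :=
  near_ring_with_identity N /\ near_field_on (units N `|` [set 0]).

Definition af_near_ring (N : nr_data) : Prop :=
  a_near_ring N /\ f_near_ring N.

Definition isomorphic_on (N M : nr_data) (S : set N) (T : set M) : Prop :=
  exists f : N -> M,
    [/\ set_bij S T f,
        forall x y, S x -> S y -> f (x + y) = f x + f y
      & forall x y, S x -> S y -> f (x * y) = f x * f y].

Definition mul_group_automorphism (F : nr_data) (f : F -> F) : Prop :=
  set_bij ([set: F] `\ 0) ([set: F] `\ 0) f /\
  forall x y : F, x <> 0 -> y <> 0 -> f (x * y) = f x * f y.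

(* F^k with k = n.+1; the last coordinate a_k is a ord_max. *)
Section PowerNearRing.
Variables (F : nr_data) (n : nat) (alpha : 'I_n.+1 -> F -> F).

Definition pow_zero : {ffun 'I_n.+1 -> F} := [ffun=> 0].

Definition pow_add (x y : {ffun 'I_n.+1 -> F}) : {ffun 'I_n.+1 -> F} :=
  [ffun i => x i + y i].

Definition pow_last (c : F) : {ffun 'I_n.+1 -> F} :=
  [ffun i => if i == ord_max then c else 0].

(* The last coordinate of the first case is x_k * alpha_k(a_k), which is
   x_k * a_k because alpha_k is the identity in all uses. *)
Definition pow_mul (x a : {ffun 'I_n.+1 -> F}) : {ffun 'I_n.+1 -> F} :=
  if `[< forall i, i != ord_max -> a i = 0 >]
  then [ffun i => x i * alpha i (a ord_max)]
  else [ffun i => x ord_max * a i].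

Definition pow_near_ring : nr_data := NrData pow_zero pow_add pow_mul.

End PowerNearRing.

(* Main.v *)
(* Both cases of x *_1 a have last coordinate x_k a_k, and a *_1 b
   stays outside the axis {(0,...,0,c)} whenever one of a, b does and the result
   is nonzero.  Hence associativity reduces to that of F and to the
   multiplicativity of the alpha_i, and an element off the axis is never a unit:
   v *_1 u = (v_k u_1,...,v_k u_k) is (0,...,0,1) only if v_k = 0, which is
   absurd. *)
Require Import Defs.
From mathcomp Require Import all_boot.
From mathcomp Require Import boolp classical_sets functions.

Local Open Scope classical_set_scope.
Local Open Scope near_ring_scope.

(** * Transport of groups and near-fields along homomorphisms *)

Lemma group_on_image (T T' : Type) (S : set T) (op : T -> T -> T) (e : T)
    (op' : T' -> T' -> T') (f : T -> T') :
  (forall x y, f (op x y) = op' (f x) (f y)) ->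
  group_on S op e -> group_on (f @` S) op' (f e).
Proof.
move=> fM [opS opA Se ope opV]; split.
- by move=> _ _ [x Sx <-] [y Sy <-]; exists (op x y); [exact: opS|].
- move=> _ _ _ [x Sx <-] [y Sy <-] [z Sz <-].
  by rewrite -!fM opA.
- by exists e.
- by move=> _ [x Sx <-]; rewrite -!fM !(ope x Sx).1 (ope x Sx).2.
- move=> _ [x Sx <-]; have [y [Sy xy yx]] := opV x Sx.
  by exists (f y); split; [exists y|rewrite -fM xy|rewrite -fM yx].
Qed.

(** Injectivity makes removing 0 commute with taking the image, so the multiplicative group is
    transported as well. *)
Lemma near_field_on_image (N M : nr_data) (S : set N) (f : N -> M) :
  injective f -> f 0 = 0 ->
  (forall x y, f (x + y) = f x + f y) ->
  (forall x y, f (x * y) = f x * f y) ->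
  near_field_on S -> near_field_on (f @` S).
Proof.
move=> f_inj f0 fD fM [[addS mulS mulA mulD mul0] [e mulG]]; split; first split.
- by rewrite -f0; exact: group_on_image.
- by move=> _ _ [x Sx <-] [y Sy <-]; exists (x * y); [exact: mulS|].
- by move=> _ _ _ [x Sx <-] [y Sy <-] [z Sz <-]; rewrite -!fM mulA.
- by move=> _ _ _ [x Sx <-] [y Sy <-] [z Sz <-]; rewrite -!(fM, fD) mulD.
- by move=> _ [x Sx <-]; rewrite -f0 -!fM (mul0 x Sx).1 (mul0 x Sx).2.
- exists (f e); suff -> : f @` S `\ 0 = f @` (S `\ 0) by exact: group_on_image.
  apply/seteqP; split=> [_ [[x Sx <-] /= fx0]|_ [x [Sx /= x0] <-]].
    by exists x => //; split=> //= x0; apply: fx0; rewrite x0.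
  by split=> [|/=]; [exists x|rewrite -f0 => /f_inj].
Qed.

Lemma is_identity_unique (N : nr_data) (e e' : N) :
  is_identity e -> is_identity e' -> e = e'.
Proof. by move=> He He'; rewrite -(He e').1 (He' e).2. Qed.

(** * Near-fields and automorphisms of their multiplicative groups *)

Section NearField.
Variables (F : nr_data) (F_near_field : near_field F).

Lemma near_field_add : group_on [set: F] nr_add 0.
Proof. by case: F_near_field => -[]. Qed.

Lemma near_field_addA (x y z : F) : x + (y + z) = x + y + z.
Proof. by have [_ addA _ _ _] := near_field_add; exact: addA. Qed.

Lemma near_field_add0 (x : F) : 0 + x = x /\ x + 0 = x.
Proof. by have [_ _ _ add0 _] := near_field_add; exact: add0. Qed.

Lemma near_field_mulA (x y z : F) : x * (y * z) = x * y * z.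
Proof. by case: F_near_field => -[_ _ mulA _ _] _; exact: mulA. Qed.

Lemma near_field_mulD (x y z : F) : (x + y) * z = x * z + y * z.
Proof. by case: F_near_field => -[_ _ _ mulD _] _; exact: mulD. Qed.

Lemma near_field_mul0 (x : F) : 0 * x = 0 /\ x * 0 = 0.
Proof. by case: F_near_field => -[_ _ _ _ mul0] _; exact: mul0. Qed.

(** Closure of the multiplicative group excludes zero divisors. *)
Lemma near_field_mul_neq0 (x y : F) : x <> 0 -> y <> 0 -> x * y <> 0.
Proof.
by case: F_near_field => _ [e [mulS _ _ _ _]] x0 y0; case: (mulS x y).
Qed.

(** The group identity acts a priori only on nonzero elements; zero symmetry extends it to 0. *)
Lemma near_field_one : exists e : F, [/\ e <> 0, is_identity e
  & forall x, x <> 0 -> exists y, [/\ y <> 0, x * y = e & y * x = e]].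
Proof.
case: F_near_field => _ [e [_ _ [_ /= e0] mul1 mulV]]; exists e; split=> //.
- move=> x; have [->|x0] := EM (x = 0).
    by rewrite (near_field_mul0 e).1 (near_field_mul0 e).2.
  by apply: mul1.
- by move=> x x0; have [//|y [[_ y0] xy yx]] := mulV x; exists y.
Qed.

Lemma near_field_mul_fixed (e x c : F) :
  is_identity e -> x <> 0 -> x * c = x -> c = e.
Proof.
move=> He x0 xc; have [e' [_ He' mulV]] := near_field_one.
have [y [_ _ yx]] := mulV x x0.
by rewrite -(He' c).1 -yx -near_field_mulA xc yx; apply: is_identity_unique.
Qed.

Section Automorphism.
Variables (f : F -> F) (f0 : f 0 = 0) (f_aut : mul_group_automorphism f).

Lemma mul_automorphism_neq0 x : x <> 0 -> f x <> 0.
Proof. by case: f_aut => -[f_fun _ _] _ x0; have [] := f_fun x. Qed.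

(** The group automorphism covers nonzero factors; [f0] and zero symmetry cover the rest. *)
Lemma mul_automorphismM x y : f (x * y) = f x * f y.
Proof.
have [->|x0] := EM (x = 0).
  by rewrite f0 !(near_field_mul0 _).1 f0.
have [->|y0] := EM (y = 0).
  by rewrite f0 !(near_field_mul0 _).2 f0.
exact: f_aut.2.
Qed.

(** The image of 1 is a nonzero idempotent, and cancelling it leaves 1. *)
Lemma mul_automorphism1 e : is_identity e -> f e = e.
Proof.
move=> He; have [e' [e'0 He' _]] := near_field_one.
rewrite (is_identity_unique _ _ _ He He').
apply: (near_field_mul_fixed _ _ _ He' (mul_automorphism_neq0 _ e'0)).
by rewrite -mul_automorphismM (He' e').1.
Qed.

(** Injectivity is available only away from 0, so [x <> 0] comes first: otherwise [f x] would be 0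
    rather than 1. *)
Lemma mul_automorphism_inj1 e x : is_identity e -> f x = e -> x = e.
Proof.
move=> He fx; have [e' [e'0 He' _]] := near_field_one.
have e0 : e <> 0 by rewrite (is_identity_unique _ _ _ He He').
case: f_aut => -[_ f_inj _] _; apply: f_inj.
- apply/mem_set; split=> //= x0; apply: e0.
  by rewrite -fx x0.
- exact/mem_set.
- by rewrite fx mul_automorphism1.
Qed.

End Automorphism.

(** * The near-ring on the k-fold power *)

Section Power.
Variables (n : nat) (alpha : 'I_n.+1 -> F -> F).
Hypothesis alpha0 : forall i, alpha i 0 = 0.
Hypothesis alpha_aut : forall i, mul_group_automorphism (alpha i).
Hypothesis alpha_last : forall x, alpha ord_max x = x.

Notation V := (pow_near_ring alpha).
Notation last := (@pow_last F n).

Lemma pow_last_max c : last c ord_max = c.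
Proof. by rewrite ffunE eqxx. Qed.

Lemma pow_last_inj : injective last.
Proof. by move=> a b ab; rewrite -(pow_last_max a) ab pow_last_max. Qed.

Lemma pow_last0 : last 0 = (0 : V).
Proof. by apply/ffunP => i; rewrite !ffunE if_same. Qed.

(** This dichotomy mirrors the test in [pow_mul] and drives the later case analyses. *)
Lemma pow_lastP (a : V) :
  a = last (a ord_max) \/ exists2 j, j != ord_max & a j <> 0.
Proof.
have [aE|] := EM (forall i, i != ord_max -> a i = 0).
  left; apply/ffunP => i; rewrite ffunE.
  by have [->|/aE] := eqVneq i ord_max.
by move=> /existsNP[j /not_implyP[jn aj]]; right; exists j.
Qed.

Lemma pow_addE (x y : V) i : (x + y) i = x i + y i.
Proof. by rewrite ffunE. Qed.

Lemma pow_mul_lastE (x : V) c i : (x * (last c : V)) i = x i * alpha i c.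
Proof.
rewrite /= /pow_mul asboolT ?ffunE ?eqxx // => j /negbTE jn.
by rewrite ffunE jn.
Qed.

Lemma pow_mul_nlastE (x a : V) i :
  (exists2 j, j != ord_max & a j <> 0) -> (x * a) i = x ord_max * a i.
Proof.
by move=> [j jn aj]; rewrite /= /pow_mul asboolF ?ffunE // => /(_ j jn).
Qed.

Lemma pow_mul_max (x a : V) : (x * a) ord_max = x ord_max * a ord_max.
Proof.
have [->|/pow_mul_nlastE-> //] := pow_lastP a.
by rewrite pow_mul_lastE alpha_last pow_last_max.
Qed.

Lemma pow_last_add c d : last (c + d) = (last c : V) + last d.
Proof.
apply/ffunP => i; rewrite !ffunE; case: ifP => // _.
by rewrite (near_field_add0 0).1.
Qed.

Lemma pow_last_mul c d : last (c * d) = (last c : V) * last d.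
Proof.
apply/ffunP => i; rewrite pow_mul_lastE !ffunE.
by have [->|_] := eqVneq i; rewrite ?alpha_last // (near_field_mul0 _).1.
Qed.

Lemma pow_mul0 (x : V) : 0 * x = 0 /\ x * 0 = 0.
Proof.
split; apply/ffunP => i.
  have [->|/pow_mul_nlastE->] := pow_lastP x.
    by rewrite pow_mul_lastE !ffunE (near_field_mul0 _).1.
  by rewrite !ffunE (near_field_mul0 _).1.
(* The zero vector lies on the axis, so coordinate i of the product is [x i * alpha i 0]. *)
by rewrite -pow_last0 pow_mul_lastE pow_last0 alpha0 !ffunE (near_field_mul0 _).2.
Qed.

Lemma pow_mulA (x a b : V) : x * (a * b) = x * a * b.
Proof.
have [bE|b_nlast] := pow_lastP b.
  have [aE|[j jn aj]] := pow_lastP a.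
    apply/ffunP => i; rewrite aE bE -pow_last_mul !pow_mul_lastE.
    by rewrite mul_automorphismM // near_field_mulA.
  (* Here a is off the axis and b on it. If [b ord_max] is nonzero, so is its image under [alpha j];
     hence coordinate j of [a * b] survives and [a * b] is off the axis too. *)
  have [b0|b0] := EM (b ord_max = 0).
    by rewrite bE b0 pow_last0 !(pow_mul0 _).2.
  apply/ffunP => i; rewrite pow_mul_nlastE; last first.
    exists j => //; rewrite bE pow_mul_lastE.
    exact/near_field_mul_neq0/mul_automorphism_neq0.
  rewrite bE !pow_mul_lastE pow_mul_nlastE; last by exists j.
  by rewrite near_field_mulA.
(* Now b is off the axis and [a * b] is b scaled on the left by [a ord_max]. If that scalar is 0,
   both sides vanish; otherwise [a * b] is off the axis. *)
have [a0|a0] := EM (a ord_max = 0).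
  have -> : a * b = 0.
    by apply/ffunP => i; rewrite pow_mul_nlastE // a0 ffunE (near_field_mul0 _).1.
  apply/ffunP => i; rewrite (pow_mul0 x).2 pow_mul_nlastE // pow_mul_max a0 ffunE.
  by rewrite (near_field_mul0 (x ord_max)).2 (near_field_mul0 _).1.
apply/ffunP => i; rewrite [RHS]pow_mul_nlastE // pow_mul_max.
rewrite pow_mul_nlastE; first by rewrite pow_mul_nlastE // near_field_mulA.
have [j jn bj] := b_nlast; exists j => //.
by rewrite pow_mul_nlastE //; apply: near_field_mul_neq0.
Qed.

(** The branch of the product depends only on the right factor, so all three products use the same
    one. *)
Lemma pow_mulD (x y a : V) : (x + y) * a = x * a + y * a.
Proof.
apply/ffunP => i; rewrite pow_addE.
have [->|a_nlast] := pow_lastP a.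
  by rewrite !pow_mul_lastE pow_addE near_field_mulD.
by rewrite !pow_mul_nlastE // pow_addE near_field_mulD.
Qed.

Lemma pow_add_group : group_on [set: V] nr_add 0.
Proof.
split=> //.
- by move=> x y z _ _ _; apply/ffunP => i; rewrite !pow_addE near_field_addA.
- move=> x _; split; apply/ffunP => i; rewrite pow_addE ffunE.
    by rewrite (near_field_add0 _).1.
  by rewrite (near_field_add0 _).2.
- move=> x _; have [_ _ _ _ addV] := near_field_add.
  (* Choice collects the coordinatewise opposites into one vector. *)
  have /choice[y xy] i : exists z, x i + z = 0 /\ z + x i = 0.
    by have [//|z [_ xz zx]] := addV (x i); exists z.
  exists [ffun i => y i]; split=> //; apply/ffunP => i; rewrite pow_addE !ffunE.
    exact: (xy i).1.
  exact: (xy i).2.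
Qed.

Lemma pow_near_ringP : near_ring V.
Proof.
split=> //; [exact: pow_add_group|move=> *; exact: pow_mulA
  |move=> *; exact: pow_mulD|move=> *; exact: pow_mul0].
Qed.

(** It is a right identity because every [alpha i] fixes 1, and a left one because its last
    coordinate is 1. *)
Lemma pow_identity e : is_identity e -> is_identity (last e : V).
Proof.
move=> He x; split; apply/ffunP => i; last first.
  by rewrite pow_mul_lastE (mul_automorphism1 (alpha i)) // (He _).2.
have [->|/pow_mul_nlastE->] := pow_lastP x; last by rewrite pow_last_max (He _).1.
by rewrite -pow_last_mul (He _).1.
Qed.

Lemma pow_units : units V = [set u : V | exists2 a : F, a <> 0 & u = last a].
Proof.
have [e [e0 He mulV]] := near_field_one.
apply/seteqP; split=> [u [e' [v [He' uv vu]]]|_ [a a0 ->]]; last first.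
  have [b [_ ab ba]] := mulV a a0; exists (last e), (last b).
  by split; [exact: pow_identity|rewrite -pow_last_mul ab|rewrite -pow_last_mul ba].
have e'E := is_identity_unique _ _ _ He' (pow_identity _ He).
have vu_max : v ord_max * u ord_max = e.
  by rewrite -pow_mul_max vu e'E pow_last_max.
have [uE|[j jn uj]] := pow_lastP u.
  exists (u ord_max) => // u0; apply: e0.
  by rewrite -vu_max u0 (near_field_mul0 _).2.
have v0 : v ord_max <> 0.
  by move=> v0; apply: e0; rewrite -vu_max v0 (near_field_mul0 _).1.
(* Coordinate j of [v * u] is [v ord_max * u j], whereas the identity vanishes there. *)
have [] := near_field_mul_neq0 _ _ v0 uj.
rewrite -pow_mul_nlastE; last by exists j.
by rewrite vu e'E ffunE (negbTE jn).
Qed.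

(** As an image of F, this set inherits the near-field structure through [last]. *)
Lemma pow_units_setU0 : units V `|` [set (0 : V)] = range (last : F -> V).
Proof.
rewrite pow_units; apply/seteqP; split=> [u [[a _ ->]|->]|_ [a _ <-]].
- by exists a.
- by exists 0; rewrite ?pow_last0.
- have [->|a0] := EM (a = 0); first by right; rewrite /= pow_last0.
  by left; exists a.
Qed.

Lemma pow_near_ring_with_identity : near_ring_with_identity V.
Proof.
split; first exact: pow_near_ringP.
by have [e [_ He _]] := near_field_one; exists (last e); exact: pow_identity.
Qed.

Lemma pow_a_near_ring : a_near_ring V.
Proof.
split; first exact: pow_near_ring_with_identity.
rewrite pow_units_setU0; apply: near_field_on_image => //.
- exact: pow_last_inj.
- exact: pow_last0.
- exact: pow_last_add.
- exact: pow_last_mul.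
Qed.

(* If x * (0,...,0,a) = x with x_i <> 0, then alpha_i(a) = 1, hence a = 1. *)
Lemma pow_f_near_ring : f_near_ring V.
Proof.
split; first exact: pow_near_ring_with_identity.
rewrite pow_units => _ [a a0 ->] psi_neq x xa; have [e [_ He _]] := near_field_one.
apply/ffunP => i; rewrite ffunE; apply: contrapT => xi; apply: psi_neq.
have ae : a = e.
  apply: (mul_automorphism_inj1 _ (alpha0 i) (alpha_aut i)) => //.
  by apply: (near_field_mul_fixed _ _ _ He xi); rewrite -pow_mul_lastE xa.
by apply/funext => y; rewrite /psi ae (pow_identity _ He _).2.
Qed.

(** The last coordinate respects both operations on all of V and inverts [last] on the axis. *)
Lemma pow_units_iso : isomorphic_on (units V `|` [set (0 : V)]) [set: F].
Proof.
rewrite pow_units_setU0; exists (fun x : V => x ord_max); split.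
- split=> //.
  + move=> _ _ /set_mem[a _ <-] /set_mem[b _ <-].
    by rewrite !pow_last_max => ->.
  + by move=> a _; exists (last a); [exists a|exact: pow_last_max].
- by move=> x y _ _; rewrite pow_addE.
- by move=> x y _ _; rewrite pow_mul_max.
Qed.

End Power.
End NearField.

Theorem theorem4p5 (F : nr_data) (F_near_field : near_field F)
    (n : nat) (alpha : 'I_n.+1 -> F -> F)
    (alpha0 : forall i, alpha i 0 = 0)
    (alpha_aut : forall i, mul_group_automorphism (alpha i))
    (alpha_last : forall x, alpha ord_max x = x) :
  let V := pow_near_ring alpha in
  let U := [set u : V | exists2 a : F, a <> 0 & u = pow_last n a] in
  [/\ af_near_ring V,
      units V = U,
      (exists2 e : F, is_identity e & is_identity (pow_last n e : V))
    & isomorphic_on (U `|` [set (0 : V)]) [set: F]].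
Proof.
(* Folding the explicit set back into [units V] makes the second conjunct trivial. *)
rewrite /= -(pow_units F _ n alpha) //; split=> //.
- by split; [exact: pow_a_near_ring|exact: pow_f_near_ring].
- have [e [_ He _]] := near_field_one _ F_near_field.
  by exists e => //; exact: pow_identity.
- exact: pow_units_iso.
Qed.
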